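(* (i) Let $n\ge 2$, let $a=(a_1,\dots,a_n)^T\in\mathbb{Z}^n$ have all entries $a_i\neq 0$ and $\gcd(a_1,\dots,a_n)=1$, and let $b\in\mathbb{Z}$. Then $$d(a,b)\le \|a\|_\infty-1.$$ (ii) For any positive integer $k$ and any dimension $n\ge 2$ there exist $a\in\mathbb{Z}^n$ with all entries nonzero, $\gcd(a_1,\dots,a_n)=1$ and $\|a\|_\infty=k$, and $b\in\mathbb{Z}$, such that $$d(a,b)=\|a\|_\infty-1.$$
   Context: For $a\in\mathbb{Z}^n$ and $b\in\mathbb{Z}$ the knapsack polyhedron is $P(a,b)=\{x\in\mathbb{R}^n_{\ge 0}: a^Tx=b\}$. The (maximum) vertex distance is $$d(a,b)=\max_{v}\ \min_{z\in P(a,b)\cap\mathbb{Z}^n}\|v-z\|_\infty \quad\text{if } P(a,b)\cap\mathbb{Z}^n\neq\emptyset,\qquad d(a,b)=-\infty\ \text{ otherwise},$$ where the maximum is over all vertices $v$ of the polyhedron $P(a,b)$ and $\|\cdot\|_\infty$ is the $\ell_\infty$-norm. *)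

(* Defs.v *)
From mathcomp Require Export all_boot all_order all_algebra.
From mathcomp Require Export all_classical all_reals all_analysis.

Set Implicit Arguments.
Unset Strict Implicit.
Unset Printing Implicit Defensive.

Import Order.TTheory GRing.Theory Num.Theory.
Import numFieldNormedType.Exports.

Local Open Scope classical_set_scope.
Local Open Scope ring_scope.

(* The equation a^T x = b is between 1 x 1 matrices. *)
Definition knapsack (R : realType) (n : nat) (a : 'cV[int]_n) (b : int) :
    set 'cV[R]_n :=
  [set x : 'cV[R]_n | (forall i, 0 <= x i 0) /\
           (map_mx (intr : int -> R) a)^T *m x = (b%:~R : R)%:M].

Definition integer_vectors (R : realType) (n : nat) : set 'cV[R]_n :=
  range (map_mx (intr : int -> R) : 'cV[int]_n -> 'cV[R]_n).

(* Vertices as extreme points: v is in P and is not a proper convex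
   combination of points of P other than v. *)
Definition vertices (R : realType) (n : nat) (P : set 'cV[R]_n) :
    set 'cV[R]_n :=
  [set v : 'cV[R]_n | P v /\
     forall (x y : 'cV[R]_n) (t : R), P x -> P y -> 0 < t < 1 ->
       v = t *: x + (1 - t) *: y -> x = v /\ y = v].

(* The norm `|_| on matrices is the maximum of the absolute values of the
   entries.  Over nonempty Z the infimum is a minimum, since a ball contains
   finitely many integer vectors, and the supremum is a maximum, since a
   nonempty knapsack polyhedron has at least one and finitely many vertices. *)
Definition vertex_distance (R : realType) (n : nat) (a : 'cV[int]_n)
    (b : int) : \bar R :=
  let P := @knapsack R n a b in
  let Z := P `&` @integer_vectors R n in
  if `[< Z !=set0 >] then
    ereal_sup [set ereal_inf [set `|v - z|%:E | z in Z] | v in vertices P]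
  else -oo%E.

Definition gcd_entries (n : nat) (a : 'cV[int]_n) : nat :=
  \big[gcdn/0%N]_i absz (a i 0).

(* Main.v *)
Require Import Defs.
From mathcomp Require Import all_boot all_order all_algebra.
From mathcomp Require Import all_classical all_reals all_analysis.
From mathcomp Require Import zify ring lra.
Import Order.TTheory GRing.Theory Num.Theory.
Import numFieldNormedType.Exports.
Local Open Scope ring_scope.

(* A vertex is 0 (then b = 0) or b/a_i e_i, and up to a global sign a_i > 0 and
   b > 0.  Take a feasible integer point z minimizing the sum of its coordinates
   outside i.
   - If z had a_i positive-weight units outside i, some of them would have total
     weight divisible by a_i and could be exchanged for copies of e_i; so their
     number is at most a_i - 1.  The same exchange with a_i negative-weight units
     costs at most |a|_oo copies of e_i, so it is blocked only if z_i < |a|_oo.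
   - If z_j >= |a|_oo with a_j < 0, the positive weights (those of i included)
     sum to more than |a_j| |a|_oo; a pigeonhole on the overshoots of their
     partial sums over multiples of |a_j| yields some of them balanced exactly by
     copies of e_j, and removing both contradicts minimality. *)

(** * Pigeonhole arguments on partial sums of a multiset *)

Lemma pigeonhole (n : nat) (F : nat -> nat) :
  (forall i, (i <= n)%N -> (F i < n)%N) ->
  exists i j, [/\ (i < j)%N, (j <= n)%N & F i = F j].
Proof.
move=> ltF; have ltFo (i : 'I_n.+1) : (F i < n)%N by apply: ltF; rewrite -ltnS.
have /injectivePn [i [j neq_ij eqF]] :
    ~~ injectiveb (fun i : 'I_n.+1 => Ordinal (ltFo i)).
  apply/negP => /injectiveP /leq_card.
  by rewrite !card_ord ltnn.
move/(congr1 val): eqF => /= eqF.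
have := neq_ij; rewrite -val_eqE /= neq_ltn => /orP[ltij|ltij].
- by exists i, j; split=> //; rewrite -ltnS.
- by exists j, i; split=> //; rewrite -ltnS.
Qed.

Lemma Posz_sum (I : finType) (P : pred I) (F : I -> nat) :
  (\sum_(j | P j) F j)%N%:Z = \sum_(j | P j) (F j)%:Z.
Proof. exact: (big_morph Posz PoszD (erefl _)). Qed.

Lemma sum_seq_count (I : finType) (f : I -> int) (s : seq I) :
  \sum_(j <- s) f j = \sum_j f j * (count_mem j s)%:Z.
Proof.
elim: s => [|x s IHs]; first by rewrite big_nil big1 // => j _; rewrite mulr0.
rewrite big_cons IHs; under [RHS]eq_bigr => j _ do rewrite /= PoszD mulrDr.
rewrite big_split /=; congr (_ + _).
rewrite (bigD1 x) //= eqxx mulr1 big1 ?addr0 // => j.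
by rewrite eq_sym => /negPf->; rewrite mulr0.
Qed.

(** Listing the units of z one by one gives a walk of prefix sums; the block between two prefixes is
    a submultiset whose sum is the difference of the prefix sums. *)
Lemma multiset_seq (I : finType) (P : pred I) (z : I -> nat) :
  exists s : seq I, forall j, count_mem j s = (P j * z j)%N.
Proof.
exists (flatten [seq nseq (P j * z j) j | j <- enum I]) => j.
rewrite count_flatten -map_comp sumnE big_map big_enum (bigD1 j) //=.
rewrite count_nseq /= eqxx mul1n big1 ?addn0 // => i /negPf nij.
by rewrite count_nseq /= nij.
Qed.

Lemma sum_take_drop (I : finType) (f : I -> int) (s : seq I) (k l : nat) :
  (k <= l)%N ->
  \sum_(j <- drop k (take l s)) f j =
    \sum_(j <- take l s) f j - \sum_(j <- take k s) f j.
Proof.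
move=> lekl; rewrite -[in X in _ = X - _](cat_take_drop k (take l s)).
by rewrite big_cat /= take_takel //; ring.
Qed.

Lemma count_drop_take (I : finType) (s : seq I) (k l : nat) (j : I) :
  (count_mem j (drop k (take l s)) <= count_mem j s)%N.
Proof.
rewrite -[in leqRHS](cat_take_drop l s) -[in leqRHS](cat_take_drop k (take l s)).
by rewrite !count_cat; lia.
Qed.

Lemma size_sum_count (I : finType) (s : seq I) :
  size s = (\sum_j count_mem j s)%N.
Proof.
have := sum_seq_count I (fun=> 1) s.
rewrite big_const_seq count_predT iter_addr_0 => eq1.
apply/eqP; rewrite -eqz_nat -[(size s)%:Z]natz eq1 -[(\sum_j _)%N : int]natz.
rewrite natr_sum; apply/eqP/eq_bigr => j _; by rewrite mul1r natz.
Qed.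

(** Among the prefix sums of lengths 0 to d two agree modulo d; the block between them has between 1
    and d units. *)
Lemma dvdz_submultiset (I : finType) (P : pred I) (z : I -> nat)
    (f : I -> int) (d : nat) :
  (0 < d)%N -> (d <= \sum_(j | P j) z j)%N ->
  exists y : I -> nat, [/\ forall j, (y j <= P j * z j)%N,
    (0 < \sum_j y j)%N, (\sum_j y j <= d)%N &
    (d%:Z %| \sum_j f j * (y j)%:Z)%Z].
Proof.
move=> d0 led; have [s sP] := multiset_seq I P z.
have size_s : size s = (\sum_(j | P j) z j)%N.
  rewrite size_sum_count [RHS]big_mkcond; apply: eq_bigr => j _.
  by rewrite sP; case: (P j); rewrite ?mul1n ?mul0n.
pose S k := \sum_(j <- take k s) f j.
have [i _|k [l [ltkl led' eqF]]] :=
    pigeonhole d (fun k => `|(S k %% d%:Z)%Z|%N) _.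
  by have := ltz_pmod (S i) (d := d%:Z); have := modz_ge0 (S i) (d := d%:Z); lia.
have size_b : size (drop k (take l s)) = (l - k)%N.
  by rewrite size_drop size_takel // size_s; lia.
exists (fun j => count_mem j (drop k (take l s))); split.
- by move=> j; rewrite -sP count_drop_take.
- by rewrite -size_sum_count size_b; lia.
- by rewrite -size_sum_count size_b; lia.
rewrite -sum_seq_count sum_take_drop 1?ltnW // -/(S l) -/(S k) -eqz_mod_dvd.
apply/eqP; have := modz_ge0 (S k) (d := d%:Z); have := modz_ge0 (S l) (d := d%:Z).
lia.
Qed.

(* For each t <= A cut the walk of partial sums at the first point where it
   reaches m t; the A + 1 overshoots lie in [0, A - 1], so two of them agree. *)
Lemma multiple_submultiset (I : finType) (P : pred I) (z : I -> nat)
    (f : I -> int) (A m : nat) :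
  (0 < m)%N -> (0 < A)%N -> (forall j, P j -> 0 < f j <= A%:Z) ->
  (m * A)%:Z <= \sum_(j | P j) f j * (z j)%:Z ->
  exists (y : I -> nat) (t : nat), [/\ forall j, (y j <= P j * z j)%N,
    (0 < t <= A)%N & \sum_j f j * (y j)%:Z = (m * t)%:Z].
Proof.
move=> m0 A0 fP lemA; have [s sP] := multiset_seq I P z.
pose S k := \sum_(j <- take k s) f j.
have S0 : S 0%N = 0 by rewrite /S take0 big_nil.
have Send : S (size s) = \sum_(j | P j) f j * (z j)%:Z.
  rewrite /S take_size sum_seq_count [RHS]big_mkcond; apply: eq_bigr => j _.
  by rewrite sP; case: (P j); rewrite ?mul1n ?mul0n ?mulr0.
have SS k : S k.+1 <= S k + A%:Z.
  have [lts|ges] := ltnP k (size s); last by rewrite /S !take_oversize //; lia.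
  have [x0 xs] : exists x, x \in s.
    by exists (tnth (in_tuple s) (Ordinal lts)); exact: mem_tnth.
  rewrite /S (take_nth x0) // -cats1 big_cat big_seq1 lerD2l.
  have : nth x0 s k \in s by rewrite mem_nth.
  rewrite -has_pred1 has_count sP muln_gt0 => /andP[+ _].
  by case Px : (P _) => // _; case/andP: (fP _ Px).
have ex_l t : (t <= A)%N -> exists k, (m * t)%:Z <= S k.
  move=> letA; exists (size s); rewrite Send; apply: le_trans lemA.
  by rewrite lez_nat leq_mul.
(* The length of the shortest prefix with sum at least m t; the value 0 for t > A is a
   placeholder. *)
pose l t := if (t <= A)%N =P true is ReflectT h then ex_minn (ex_l t h) else 0%N.
have lP t : (t <= A)%N -> (m * t)%:Z <= S (l t) /\
    (forall k, (m * t)%:Z <= S k -> (l t <= k)%N).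
  by move=> letA; rewrite /l; case: eqP => // h; case: ex_minnP.
(* The prefix one unit shorter is still below m t, and the last unit adds at most A. The empty
   prefix is chosen only when m t = 0. *)
have overP t : (t <= A)%N -> 0 <= S (l t) - (m * t)%:Z < A%:Z.
  move=> letA; have [ge_l min_l] := lP t letA; rewrite subr_ge0 ge_l /=.
  have [lt0|lt0] := posnP (l t).
    rewrite lt0 S0; lia.
  have := SS (l t).-1; rewrite prednK //.
  have : ~~ ((m * t)%:Z <= S (l t).-1) by apply/negP => /min_l; lia.
  lia.
have [i leiA|t [t' [lttt' let'A eqF]]] :=
    pigeonhole A (fun t => `|S (l t) - (m * t)%:Z|%N) _.
  by have := overP _ leiA; lia.
have letA : (t <= A)%N by lia.
have [ge_l' _] := lP t' let'A; have [_ min_l] := lP t letA.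
have le_l : (l t <= l t')%N.
  by apply: min_l; apply: le_trans ge_l'; rewrite lez_nat leq_mul // ltnW.
exists (fun j => count_mem j (drop (l t) (take (l t') s))), (t' - t)%N; split.
- by move=> j; rewrite -sP count_drop_take.
- lia.
rewrite -sum_seq_count sum_take_drop // -/(S _) -/(S _).
have := overP _ letA; have := overP _ let'A; rewrite mulnBr.
have : (m * t <= m * t')%N by rewrite leq_mul // ltnW.
lia.
Qed.

(** * The integer solution near an axis vertex *)

(** The vertex is b / a_i0 on axis i0 and 0 elsewhere, so the last two conclusions say that z is
    within A - 1 of it, with the denominator cleared at i0. *)
Lemma close_solution (I : finType) (a : I -> int) (b : int) (i0 : I) (A : nat) :
  (forall j, `|a j| <= A%:Z) -> 0 < a i0 -> 0 < b ->
  (exists z : I -> nat, \sum_j a j * (z j)%:Z = b) ->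
  exists z : I -> nat, [/\ \sum_j a j * (z j)%:Z = b,
    forall j, j != i0 -> (z j < A)%N &
    `|a i0 * (z i0)%:Z - b| <= a i0 * (A%:Z - 1)].
Proof.
move=> leA a0 b0 ex_z.
pose weight (z : I -> nat) := (\sum_(j | j != i0) z j)%N.
have [z zb min_z] : exists2 z : I -> nat, \sum_j a j * (z j)%:Z = b &
    forall z' : I -> nat, \sum_j a j * (z' j)%:Z = b -> (weight z <= weight z')%N.
  case: ex_z => z zb; have [k] := ubnP (weight z).
  elim: k z zb => // k IHk z zb ltk.
  have [min_z|] := pselect (forall z' : I -> nat,
    \sum_j a j * (z' j)%:Z = b -> (weight z <= weight z')%N); first by exists z.
  move=> /existsNP[z' /not_implyP[z'b /negP]]; rewrite -ltnNge => ltz'.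
  by apply: (IHk z'); lia.
(* Minimality: no nontrivial kernel vector can be subtracted from z. *)
have no_w (w : I -> int) : (forall j, w j <= (z j)%:Z) ->
    \sum_j a j * w j = 0 -> \sum_(j | j != i0) w j <= 0.
  move=> lew w0.
  have absE j : (`|(z j)%:Z - w j|%N : int) = (z j)%:Z - w j.
    by have := lew j; lia.
  have := min_z (fun j => `|(z j)%:Z - w j|%N).
  under eq_bigr => j _ do rewrite absE mulrBr.
  rewrite sumrB w0 subr0 => /(_ zb); rewrite -lez_nat /weight.
  rewrite !Posz_sum.
  under [X in _ <= X]eq_bigr => j _ do rewrite absE.
  by rewrite sumrB lerBrDr gerDl.
(* Exchanging y for q copies of i0 subtracts the kernel vector y - q e_i0 and lowers the weight.
   Minimality must block it, and only coordinate i0 can become negative. *)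
have no_y (y : I -> nat) (q : int) : y i0 = 0%N -> (forall j, (y j <= z j)%N) ->
    (0 < \sum_j y j)%N -> \sum_j a j * (y j)%:Z = a i0 * q ->
    (z i0)%:Z + q < 0.
  move=> y0 ley sy0 yq; rewrite ltNge; apply/negP => q_ge.
  have := no_w (fun j => if j == i0 then - q else (y j)%:Z).
  have -> : \sum_(j | j != i0) (if j == i0 then - q else (y j)%:Z) =
      (\sum_j y j)%N.
    rewrite [RHS]Posz_sum [RHS](bigD1 i0) //= y0 add0r.
    by apply: eq_bigr => j /negPf->.
  have -> : \sum_j a j * (if j == i0 then - q else (y j)%:Z) = 0.
    rewrite (bigD1 i0) //= eqxx; move: yq; rewrite (bigD1 i0) //= y0 mulr0 add0r.
    move=> yq; rewrite (eq_bigr (fun j => a j * (y j)%:Z)) => [|j /negPf-> //].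
    by rewrite yq; ring.
  have le_w j : (if j == i0 then - q else (y j)%:Z) <= (z j)%:Z.
    by case: eqP => [->|_]; [lia | exact: ley].
  by move=> /(_ le_w erefl); lia.
have [d a0E] : exists d : nat, a i0 = d%:Z by exists `|a i0|%N; lia.
have d0 : (0 < d)%N by lia.
have ledA : (d <= A)%N by have := leA i0; lia.
pose pos j := (j != i0) && (0 <= a j); pose neg j := (j != i0) && (a j < 0).
(* Otherwise a block of such units has total weight q d with q >= 0, and its exchange only increases
   coordinate i0. *)
have few_pos : (\sum_(j | pos j) z j < d)%N.
  rewrite ltnNge; apply/negP => /(dvdz_submultiset _ _ _ a _ d0).
  move=> [y [yP y0 _ /dvdzP[q qE]]].
  have := no_y y q _ _ y0 _.
  have yi0 : y i0 = 0%N by have := yP i0; rewrite /pos eqxx; lia.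
  have ley j : (y j <= z j)%N by have := yP j; case: (pos j); lia.
  move=> /(_ yi0 ley); rewrite qE a0E mulrC => /(_ erefl).
  have : 0 <= q * d%:Z.
    rewrite -qE sumr_ge0 // => j _; have := yP j; rewrite /pos.
    have [aj0 _|aj0] := leP 0 (a j); first by rewrite mulr_ge0.
    by rewrite andbF mul0n leqn0 => /eqP->; rewrite mulr0.
  by rewrite pmulr_lge0 ?ltz_nat //; lia.
have bE : b = a i0 * (z i0)%:Z + \sum_(j | pos j) a j * (z j)%:Z
            + \sum_(j | neg j) a j * (z j)%:Z.
  rewrite -zb (bigD1 i0) //= -addrA; congr (_ + _).
  rewrite (bigID (fun j => 0 <= a j)) /=; congr (_ + _).
  by apply: eq_bigl => j; rewrite /neg ltNge.
have le_sum (Q : pred I) :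
    `|\sum_(j | Q j) a j * (z j)%:Z| <= A%:Z * (\sum_(j | Q j) z j)%N.
  apply: le_trans (ler_norm_sum _ _ _) _.
  rewrite Posz_sum mulr_sumr; apply: ler_sum => j _.
  by rewrite normrM ler_wpM2r.
have pos_ge0 : 0 <= \sum_(j | pos j) a j * (z j)%:Z.
  by apply: sumr_ge0 => j /andP[_ aj]; rewrite mulr_ge0.
have neg_le0 : \sum_(j | neg j) a j * (z j)%:Z <= 0.
  by apply: sumr_le0 => j /andP[_ aj]; rewrite mulr_le0_ge0 // ltW.
exists z; split=> //.
- move=> j ji0; have [aj|aj] := leP 0 (a j).
    apply: leq_trans ledA; apply: leq_ltn_trans few_pos.
    by rewrite (bigD1 j) ?leq_addr // /pos ji0 aj.
  rewrite ltnNge; apply/negP => leAz.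
  have [m ajE] : exists m : nat, a j = - m%:Z by exists `|a j|%N; lia.
  have m0 : (0 < m)%N by lia.
  have A0 : (0 < A)%N by lia.
  (* Coordinate j alone contributes at most - m A, and the total b is positive. *)
  have large : (m * A)%:Z <= \sum_(k | 0 < a k) a k * (z k)%:Z.
    have : \sum_(k | ~~ (0 < a k)) a k * (z k)%:Z <= - (m * A)%:Z.
      rewrite (bigD1 j) /=; last by lia.
      have : \sum_(k | ~~ (0 < a k) && (k != j)) a k * (z k)%:Z <= 0.
        by apply: sumr_le0 => k /andP[ak _]; rewrite mulr_le0_ge0 // leNgt.
      have : (m * A <= m * z j)%N by rewrite leq_mul.
      by move=> le1 le2; rewrite -[leRHS]addr0 lerD // ajE mulNr -PoszM lerN2 lez_nat.
    have := zb; rewrite (bigID (fun k => 0 < a k)) /=.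
    by move: (\sum_(k | 0 < a k) _) (\sum_(k | ~~ (0 < a k)) _) => p q; lia.
  have aP k : 0 < a k -> 0 < a k <= A%:Z by have := leA k; lia.
  have [y [t [yP tP yt]]] := multiple_submultiset _ _ _ _ _ _ m0 A0 aP large.
  have yj : y j = 0%N by have := yP j; rewrite (_ : 0 < a j = false); lia.
  (* The units y weigh m t and cancel against t copies of j, available since t <= A <= z_j. As j
     differs from i0 and t > 0, the weight drops even if y lies entirely on i0. *)
  have := no_w (fun k => (y k)%:Z + (if k == j then t else 0%N)%:Z).
  have le_w k : (y k)%:Z + (if k == j then t else 0%N)%:Z <= (z k)%:Z.
    case: eqP => [->|_]; first by lia.
    by have := yP k; case: (0 < a k); lia.
  have -> : \sum_k a k * ((y k)%:Z + (if k == j then t else 0%N)%:Z) = 0.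
    under eq_bigr => k _ do rewrite mulrDr.
    rewrite big_split /= yt [X in _ + X](bigD1 j) //= eqxx.
    rewrite big1 => [|k /negPf->]; last by rewrite mulr0.
    by rewrite ajE PoszM; ring.
  move=> /(_ le_w erefl); apply/negP; rewrite -ltNge (bigD1 j) //= eqxx.
  have : 0 <= \sum_(k | (k != i0) && (k != j))
      ((y k)%:Z + (if k == j then t else 0%N)%:Z) by apply: sumr_ge0 => k _; lia.
  by move: (\sum_(k | (k != i0) && (k != j)) _) => x; lia.
(* The difference a_i0 z_i0 - b is minus the sum of the positive and negative parts. Fewer than d
   units give a part of size at most A (d - 1), which is at most d (A - 1) because d <= A. *)
- have Adle : A%:Z * (d%:Z - 1) <= d%:Z * (A%:Z - 1) by nia.
  have := le_sum pos; have := le_sum neg.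
  have Nle (x : nat) : (x < d)%N -> A%:Z * x%:Z <= A%:Z * (d%:Z - 1).
    by move=> ltxd; rewrite ler_wpM2l //; lia.
  have := Nle _ few_pos.
  have [few_neg|] := ltnP (\sum_(j | neg j) z j) d.
    by have := Nle _ few_neg; lia.
  (* A block of at most d negative units has weight q d >= - A d, so q >= - A. The blocked exchange
     gives z_i0 < A, and b > 0 then yields the upper bound; the lower one still comes from
     [few_pos]. *)
  move=> /(dvdz_submultiset _ _ _ a _ d0) [y [yP y0 yd /dvdzP[q qE]]] h1 h2 h3.
  have yi0 : y i0 = 0%N by have := yP i0; rewrite /neg eqxx; lia.
  have ley j : (y j <= z j)%N by have := yP j; case: (neg j); lia.
  have := no_y y q yi0 ley y0; rewrite qE a0E mulrC => /(_ erefl) zq.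
  have : - (A * d)%:Z <= q * d%:Z.
    rewrite -qE lerNl -sumrN.
    have : (A * \sum_j y j <= A * d)%N by rewrite leq_mul.
    rewrite -lez_nat; apply: le_trans.
    rewrite PoszM Posz_sum mulr_sumr; apply: ler_sum => j _.
    by rewrite -mulNr ler_wpM2r //; have := leA j; lia.
  rewrite PoszM -mulNr ler_pM2r // => leq.
  have : d%:Z * (z i0)%:Z <= d%:Z * (A%:Z - 1) by rewrite ler_wpM2l //; lia.
  by lia.
Qed.

(** * Norm, feasibility and vertices in coordinates *)

Lemma mx_entry_le_norm (K : realDomainType) (m n : nat) (x : 'M[K]_(m, n)) i j :
  `|x i j| <= `|x|.
Proof.
rewrite [leRHS]/Num.Def.normr /= mx_normrE.
by apply: le_trans (le_bigmax _ _ (i, j)).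
Qed.

Lemma cV_norm_le (K : realDomainType) (n : nat) (x : 'cV[K]_n) (c : K) :
  0 <= c -> (forall i, `|x i 0| <= c) -> `|x| <= c.
Proof.
move=> c0 lec; rewrite [leLHS]/Num.Def.normr /= mx_normrE.
by apply: bigmax_le => //= -[i j] _ /=; rewrite ord1.
Qed.

Lemma knapsackP (R : realType) (n : nat) (a : 'cV[int]_n) (b : int)
    (x : 'cV[R]_n) :
  knapsack a b x <->
  (forall i, 0 <= x i 0) /\ \sum_i (a i 0)%:~R * x i 0 = b%:~R.
Proof.
have entryE : ((map_mx (intr : int -> R) a)^T *m x) 0 0 =
    \sum_i (a i 0)%:~R * x i 0.
  by rewrite mxE; apply: eq_bigr => i _; rewrite !mxE.
split=> -[x0 xb]; split=> //.
- by rewrite -entryE xb mxE eqxx.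
- by apply/matrixP => i j; rewrite !ord1 entryE xb mxE eqxx.
Qed.

Lemma knapsackN (R : realType) (n : nat) (a : 'cV[int]_n) (b : int) :
  knapsack (R := R) (- a) (- b) = knapsack a b.
Proof.
apply/seteqP; split=> x /knapsackP[x0 xb]; apply/knapsackP; split=> //.
- apply: oppr_inj; rewrite -mulrNz -xb -sumrN; apply: eq_bigr => i _.
  by rewrite mxE mulrNz mulNr.
- rewrite mulrNz -xb -sumrN; apply: eq_bigr => i _.
  by rewrite mxE mulrNz mulNr.
Qed.

Lemma knapsack_intP (R : realType) (n : nat) (a : 'cV[int]_n) (b : int)
    (z : 'I_n -> nat) :
  \sum_i a i 0 * (z i)%:Z = b ->
  (knapsack a b `&` integer_vectors (R := R) (n := n))%classic
    (\col_i (z i)%:R).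
Proof.
move=> zb; split; last first.
  by exists (\col_i (z i)%:Z) => //; apply/matrixP => i j; rewrite !mxE.
apply/knapsackP; split=> [i|]; first by rewrite mxE ler0n.
rewrite -zb rmorph_sum /=; apply: eq_bigr => i _.
by rewrite mxE rmorphM.
Qed.

Lemma knapsack_int_inv (R : realType) (n : nat) (a : 'cV[int]_n) (b : int)
    (x : 'cV[R]_n) :
  (knapsack a b `&` integer_vectors (R := R) (n := n))%classic x ->
  exists2 z : 'I_n -> nat, \sum_i a i 0 * (z i)%:Z = b & x = \col_i (z i)%:R.
Proof.
move=> [/knapsackP[x0 xb] [y _ yx]]; rewrite -yx in x0 xb *.
have yE i : y i 0 = absz (y i 0).
  by have := x0 i; rewrite mxE ler0z; lia.
exists (fun i => absz (y i 0)).
  apply: (@intr_inj R).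
  rewrite -xb rmorph_sum /=; apply: eq_bigr => i _.
  by rewrite -yE mxE rmorphM.
by apply/matrixP => i j; rewrite !mxE ord1 {1}yE.
Qed.

(* If v had two positive entries i and j, then the direction a_j e_i - a_i e_j
   would stay in the polyhedron both ways. *)
Lemma knapsack_vertex (R : realType) (n : nat) (a : 'cV[int]_n) (b : int)
    (v : 'cV[R]_n) :
  (forall i, a i 0 != 0) -> vertices (knapsack a b) v ->
  v = 0 \/ exists2 i, 0 < v i 0 & forall j, j != i -> v j 0 = 0.
Proof.
move=> a0 [/knapsackP[v0 vb] vext].
have [v_eq0|/existsNP[i vi]] := pselect (forall i, v i 0 = 0).
  by left; apply/matrixP => i j; rewrite ord1 v_eq0 mxE.
have vi0 : 0 < v i 0 by rewrite lt0r v0 andbT; apply/eqP.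
right; exists i => // j ji; apply/eqP; apply: contraT => vj.
have vj0 : 0 < v j 0 by rewrite lt0r v0 vj.
pose ai : R := (a i 0)%:~R; pose aj : R := (a j 0)%:~R.
have ai0 : 0 < `|ai| by rewrite normr_gt0 intr_eq0.
have aj0 : 0 < `|aj| by rewrite normr_gt0 intr_eq0.
(* The largest step that keeps coordinates i and j nonnegative in both directions; v is then the
   midpoint of [w e] and [w (- e)]. *)
pose e := Num.min (v i 0 / `|aj|) (v j 0 / `|ai|).
have e0 : 0 < e by rewrite lt_min !divr_gt0.
have ei : e * `|aj| <= v i 0 by rewrite -ler_pdivlMr // ge_min lexx.
have ej : e * `|ai| <= v j 0 by rewrite -ler_pdivlMr // ge_min lexx orbT.
pose w (c : R) : 'cV[R]_n := \col_k
  (v k 0 + (if k == i then c * aj else if k == j then - c * ai else 0)).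
have ij : i != j by rewrite eq_sym.
have wP c : `|c| = e -> knapsack a b (w c).
  move=> ce; apply/knapsackP; split=> [k|].
    rewrite mxE; case: eqP => [->|_]; [|case: eqP => [->|_]].
    - by have := ei; rewrite -ce -normrM ler_norml => /andP[+ _]; lra.
    - by have := ej; rewrite -ce -normrM ler_norml => /andP[_ +]; lra.
    - by rewrite addr0.
  rewrite -vb; under eq_bigr => k _ do rewrite mxE mulrDr.
  rewrite big_split /= -[RHS]addr0; congr (_ + _).
  rewrite (bigD1 i) //= eqxx (bigD1 j) //= (negPf ji) eqxx big1 => [|k].
    by rewrite -/ai -/aj; ring.
  by case/andP=> /negPf-> /negPf->; rewrite mulr0.
have [] := vext (w e) (w (- e)) 2^-1.
- by apply: wP; rewrite gtr0_norm.
- by apply: wP; rewrite normrN gtr0_norm.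
- by lra.
- by apply/matrixP => k l; rewrite !mxE ord1; do 2?case: eqP => _; field.
move=> /matrixP/(_ i 0); rewrite mxE eqxx => /eqP.
by rewrite -subr_eq0 addrAC subrr add0r mulf_eq0 gt_eqF //= -normr_eq0 gt_eqF.
Qed.

(** * The upper bound *)

Lemma mx_norm_ge1 (n : nat) (a : 'cV[int]_n) (i : 'I_n) :
  a i 0 != 0 -> 1 <= `|a|.
Proof.
move=> ai; apply: le_trans (mx_entry_le_norm _ _ _ a i 0).
by rewrite -gtz0_ge1 normr_gt0.
Qed.

Lemma axis_point_close (R : realType) (n : nat) (a : 'cV[int]_n) (b : int)
    (v : 'cV[R]_n) (i : 'I_n) :
  knapsack a b v -> 0 < a i 0 -> 0 < v i 0 -> (forall j, j != i -> v j 0 = 0) ->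
  (knapsack a b `&` integer_vectors (R := R) (n := n) !=set0)%classic ->
  exists2 z, (knapsack a b `&` integer_vectors (R := R) (n := n))%classic z &
    `|v - z| <= (`|a| - 1)%:~R.
Proof.
move=> /knapsackP[_ vb] ai0 vi0 vj0 [_ /knapsack_int_inv[z0 z0b _]].
have {}vb : (a i 0)%:~R * v i 0 = b%:~R.
  by rewrite -vb (bigD1 i) //= big1 ?addr0 // => j /vj0->; rewrite mulr0.
have b0 : 0 < b by rewrite -(ltr0z R) -vb mulr_gt0 // ltr0z.
have ge1 : 1 <= `|a| by apply: (mx_norm_ge1 _ _ i); rewrite gt_eqF.
have [A aA] : exists A : nat, `|a| = A%:Z by exists (absz `|a|); lia.
have leA j : `|a j 0| <= A%:Z by rewrite -aA mx_entry_le_norm.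
have [z [zb zj zi]] :=
  close_solution _ (fun j => a j 0) b i A leA ai0 b0 (ex_intro _ z0 z0b).
exists (\col_j (z j)%:R); first exact: knapsack_intP.
rewrite aA; apply: cV_norm_le => [|j]; first by rewrite ler0z; lia.
rewrite !mxE; have [->|ji] := eqVneq j i.
  have ai0R : 0 < (a i 0)%:~R :> R by rewrite ltr0z.
  rewrite -(ler_pM2l ai0R) -[X in X * `|_|](gtr0_norm ai0R) -normrM mulrBr vb.
  rewrite -rmorphM -[(z i)%:R]/((z i)%:Z%:~R) -rmorphM -rmorphB /=.
  by rewrite -intr_norm ler_int distrC.
rewrite vj0 // sub0r normrN ger0_norm // -[(z j)%:R]/((z j)%:Z%:~R) ler_int.
by have := zj _ ji; lia.
Qed.

Lemma vertex_close (R : realType) (n : nat) (a : 'cV[int]_n) (b : int)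
    (v : 'cV[R]_n) :
  (0 < n)%N -> (forall i, a i 0 != 0) -> vertices (knapsack a b) v ->
  (knapsack a b `&` integer_vectors (R := R) (n := n) !=set0)%classic ->
  exists2 z, (knapsack a b `&` integer_vectors (R := R) (n := n))%classic z &
    `|v - z| <= (`|a| - 1)%:~R.
Proof.
move=> n0 a0 vert Z0; have [Pv _] := vert.
have [v0|[i vi vj]] := knapsack_vertex _ _ _ _ _ a0 vert.
  (* The vertex 0 is itself a feasible integer point. *)
  exists v; last first.
    by rewrite subrr normr0 ler0z subr_ge0 (mx_norm_ge1 _ _ (Ordinal n0)).
  split=> //; exists 0 => //; rewrite v0; apply/matrixP => i j; by rewrite !mxE.
have [ai|ai|/eqP] := ltgtP 0 (a i 0); last by rewrite eq_sym (negPf (a0 i)).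
  exact: (axis_point_close _ _ _ _ _ i).
(* Negating both a and b keeps the polyhedron and the norm, and makes the coefficient at i
   positive. *)
have := axis_point_close R n (- a) (- b) v i; rewrite knapsackN normrN; apply=> //.
by rewrite mxE oppr_gt0.
Qed.

Lemma vertex_distance_le (R : realType) (n : nat) (a : 'cV[int]_n) (b : int) :
  (0 < n)%N -> (forall i, a i 0 != 0) ->
  (vertex_distance R a b <= (`|a| - 1)%:~R%:E)%E.
Proof.
move=> n0 a0; rewrite /vertex_distance; case: asboolP => [Z0|_]; last by rewrite leNye.
apply: ge_ereal_sup => _ [v vert <-].
have [z Zz le_vz] := vertex_close _ _ _ _ _ n0 a0 vert Z0.
apply: (@le_trans _ _ `|v - z|%:E); last by rewrite lee_fin.
by apply: ereal_inf_lbound; exists z.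
Qed.

(** * Tightness *)

(** Off axis i the nonnegative terms t x_j and (1 - t) y_j sum to 0, so x and y lie on the axis,
    where the equation has a single solution. *)
Lemma axis_point_vertex (R : realType) (n : nat) (a : 'cV[int]_n) (b : int)
    (v : 'cV[R]_n) (i : 'I_n) :
  a i 0 != 0 -> knapsack a b v -> (forall j, j != i -> v j 0 = 0) ->
  vertices (knapsack a b) v.
Proof.
move=> ai Pv vj; split=> // x y t Px Py /andP[t0 t1] vE.
have aiR : (a i 0)%:~R != 0 :> R by rewrite intr_eq0.
have axisE (u : 'cV[R]_n) :
    knapsack a b u -> (forall j, j != i -> u j 0 = 0) -> u = v.
  have axis_eq w : knapsack a b w -> (forall j, j != i -> w j 0 = 0) ->
      (a i 0)%:~R * w i 0 = b%:~R.
    move=> /knapsackP[_ <-] wj; rewrite [RHS](bigD1 i) //= big1 ?addr0 // => j ji.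
    by rewrite wj // mulr0.
  move=> Pu uj; apply/matrixP => j k; rewrite ord1.
  have [->|ji] := eqVneq j i; last by rewrite uj // vj.
  by apply: (mulfI aiR); rewrite !axis_eq.
have /knapsackP[x0 _] := Px; have /knapsackP[y0 _] := Py.
have xy0 j : j != i -> t * x j 0 = 0 /\ (1 - t) * y j 0 = 0.
  move=> ji; have := vj _ ji; rewrite vE !mxE.
  have : 0 <= t * x j 0 by rewrite mulr_ge0 // ltW.
  have : 0 <= (1 - t) * y j 0 by rewrite mulr_ge0 // subr_ge0 ltW.
  lra.
split; apply: axisE => // j /xy0[/eqP + /eqP].
- by rewrite mulf_eq0 gt_eqF //= => /eqP.
- by move=> _; rewrite mulf_eq0 gt_eqF ?subr_gt0 //= => /eqP.
Qed.

(* The extremal instance is x_1 + k (sum of the other x_i) = k - 1, whose only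
   nonnegative integer solution is (k - 1) e_1. *)
Lemma vertex_distance_attained (R : realType) (k n : nat) :
  (0 < k)%N -> (2 <= n)%N ->
  exists (a : 'cV[int]_n) (b : int),
    [/\ forall i, a i 0 != 0, gcd_entries a = 1%N, `|a| = k%:Z &
        vertex_distance R a b = (`|a| - 1)%:~R%:E].
Proof.
move=> k0 n2; pose i0 := Ordinal (ltnW n2); pose i1 := Ordinal n2.
have i01 : i0 != i1 by [].
pose a : 'cV[int]_n := \col_i (if i == i1 then 1 else k%:Z).
have ai i : a i 0 != 0 by rewrite mxE; case: (i == i1); rewrite // eqz_nat -lt0n.
have aE : `|a| = k%:Z.
  apply/eqP; rewrite eq_le; apply/andP; split.
    by apply: cV_norm_le => // i; rewrite mxE; case: eqP => _; lia.
  apply: le_trans (mx_entry_le_norm _ _ _ a i0 0).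
  by rewrite mxE (negPf i01) ger0_norm.
exists a, (k%:Z - 1); split=> //.
  by apply/eqP; rewrite -dvdn1 (@biggcdn_inf _ i1) // mxE eqxx.
apply/eqP; rewrite eq_le vertex_distance_le ?(ltnW n2) //=.
(* If s is the sum of the coordinates other than i1, then k s <= k - 1 forces s = 0. *)
have sol_k (z : 'I_n -> nat) : \sum_i a i 0 * (z i)%:Z = k%:Z - 1 ->
    (k.-1 <= z i1)%N.
  rewrite (bigD1 i1) //= mxE eqxx mul1r.
  rewrite (eq_bigr (fun i => k%:Z * (z i)%:Z)) => [|i /negPf ii]; last first.
    by rewrite mxE ii.
  rewrite -mulr_sumr -Posz_sum; move: (\sum_(i | _) _)%N => [|s]; nia.
have ex_sol : \sum_i a i 0 * ((i == i1) * k.-1)%N%:Z = k%:Z - 1.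
  rewrite (bigD1 i1) //= mxE eqxx big1 => [|i /negPf->]; last by rewrite mulr0.
  lia.
rewrite /vertex_distance; case: asboolP => [_|[]]; last first.
  by eexists; apply: (knapsack_intP _ _ _ _ _ ex_sol).
have kR : (k%:R : R) != 0 by rewrite pnatr_eq0 -lt0n.
(* This vertex vanishes at i1, where every integer solution is at least k - 1; coordinate i1 alone
   gives the distance. *)
pose v : 'cV[R]_n := \col_i (if i == i0 then k.-1%:R / k%:R else 0).
have vj j : j != i0 -> v j 0 = 0 by move=> /negPf ji; rewrite mxE ji.
apply: le_ereal_sup_tmp.
exists (ereal_inf [set `|v - z|%:E | z in
  knapsack a (k%:Z - 1) `&` integer_vectors (R := R) (n := n)])%classic.
  exists v => //; apply: (axis_point_vertex _ _ _ _ _ i0) => //.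
  apply/knapsackP; split=> [i|].
    by rewrite mxE; case: eqP => // _; rewrite divr_ge0.
  rewrite (bigD1 i0) //= big1 => [|i /vj->]; last by rewrite mulr0.
  rewrite !mxE (negPf i01) eqxx addr0 mulrC divfK //.
  by rewrite -[k.-1%:R]/(k.-1%:Z%:~R); congr _%:~R; lia.
apply: le_ereal_inf_tmp => _ [_ /knapsack_int_inv[z zk ->] <-].
rewrite lee_fin aE; apply: le_trans (mx_entry_le_norm _ _ _ _ i1 0).
rewrite !mxE eq_sym (negPf i01) sub0r normrN ger0_norm //.
by rewrite -[(z i1)%:R]/((z i1)%:Z%:~R) ler_int; have := sol_k _ zk; lia.
Qed.

Theorem theorem1 (R : realType) :
  (forall (n : nat) (a : 'cV[int]_n) (b : int),
     (2 <= n)%N ->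
     (forall i, a i 0 != 0) ->
     gcd_entries a = 1%N ->
     (vertex_distance R a b <= (`|a| - 1)%:~R%:E)%E) /\
  (forall k n : nat,
     (0 < k)%N -> (2 <= n)%N ->
     exists (a : 'cV[int]_n) (b : int),
       [/\ forall i, a i 0 != 0,
           gcd_entries a = 1%N,
           `|a| = k%:Z &
           vertex_distance R a b = (`|a| - 1)%:~R%:E]).
Proof.
split=> [n a b n2 a0 _|k n k0 n2]; last exact: vertex_distance_attained.
exact: vertex_distance_le (ltnW n2) a0.
Qed.
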